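(* Let $s\in\mathbb{N}$. Let $u_1,v_1,\ldots,u_s,v_s\in\mathbb{N}$ satisfy $u_i\geq 2$ and $\gcd(u_i,v_i)=1$ for $1\leq i\leq s$, and $\gcd(u_i,u_j)=1$ for all $1\leq i\neq j\leq s$. For each $i\in\{1,\ldots,s\}$ let $\Sigma_i=(\sigma_{i,r})_{r\geq 1}$ be a sequence of permutations of $\{0,1,\ldots,u_i-1\}$. Let $(\boldsymbol{x}_n)_{n\geq 0}$ be the $s$-dimensional generalized Halton sequence in bases $(u_1/v_1,\ldots,u_s/v_s)$, that is, $\boldsymbol{x}_n=(\varphi^{\Sigma_1}_{u_1/v_1}(n),\ldots,\varphi^{\Sigma_s}_{u_s/v_s}(n))\in[0,1]^s$ for $n\geq 0$. Then its star discrepancy satisfies $$\limsup_{N\to\infty}\frac{N D_N^*(\boldsymbol{x}_n)}{(\log N)^s}>0.$$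
   Context: $\mathbb{N}=\{1,2,\ldots\}$ and $\mathbb{N}_0=\{0,1,2,\ldots\}$. Formal $u/v$-adic expansion: let $u\geq 2$, $v\geq 1$ be coprime integers and let $z$ be an integer. Set $z_0:=z$ and for each $r\geq 1$ let $a_r$ be the unique element of $\{0,1,\ldots,u-1\}$ such that $u\mid (v z_{r-1}-a_r)$, and set $z_r:=(v z_{r-1}-a_r)/u$ (an integer). The sequence of digits $(a_1,a_2,\ldots)$ obtained in this way is called the (formal) $u/v$-adic expansion of $z$, written formally as $\sum_{r\geq 1}\frac{a_r}{v}\left(\frac{u}{v}\right)^{r-1}$; no convergence is required and infinitely many digits may be nonzero. Radical inverse function: for a sequence $\Sigma=(\sigma_r)_{r\geq 1}$ of permutations of $\{0,1,\ldots,u-1\}$, the function $\varphi^{\Sigma}_{u/v}:\mathbb{N}_0\to[0,1]$ is defined by $\varphi^{\Sigma}_{u/v}(n)=\sum_{r\geq 1}\sigma_r(a_r)u^{-r}$, where $(a_1,a_2,\ldots)$ is the $u/v$-adic expansion of $n$. Star discrepancy: for a sequence $(\boldsymbol{x}_n)_{n\geq 0}$ in $[0,1]^s$ and $N\in\mathbb{N}$, $$D_N^*(\boldsymbol{x}_n)=\sup_{\boldsymbol{y}\in(0,1]^s}\left|\frac{\#\{0\leq n<N: x_n^{(i)}<y^{(i)},\ i=1,\ldots,s\}}{N}-\prod_{i=1}^s y^{(i)}\right|,$$ where $x_n^{(i)}$ and $y^{(i)}$ denote the $i$th components of $\boldsymbol{x}_n$ and $\boldsymbol{y}$. *)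

(* Defs.v *)
From HB Require Import structures.
From mathcomp Require Import all_boot all_order perm all_algebra.
From mathcomp Require Import all_classical all_reals all_analysis.

Set Implicit Arguments.
Unset Strict Implicit.
Unset Printing Implicit Defensive.

Import Order.TTheory GRing.Theory Num.Theory.
Import numFieldNormedType.Exports.

Local Open Scope classical_set_scope.
Local Open Scope ring_scope.

(* One step z_{r-1} |-> z_r of the u/v-adic expansion; for u > 0,
   (v * z %% u)%Z is the only a in {0, ..., u - 1} such that u divides
   v * z - a, so the quotient is exact. *)
Definition uv_step (u v : nat) (z : int) : int :=
  ((v%:Z * z - (v%:Z * z %% u%:Z)%Z) %/ u%:Z)%Z.

Definition uv_state (u v : nat) (z : int) (r : nat) : int :=
  iter r (uv_step u v) z.

(* The digit a_r, meaningful for r >= 1. *)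
Definition uv_digit (u v : nat) (z : int) (r : nat) : nat :=
  `|(v%:Z * uv_state u v z r.-1 %% u%:Z)%Z|%N.

(* The permutation p of {0, ..., u - 1} acting on nat; the default value a
   only matters for a >= u, hence never for a digit in base u > 0. *)
Definition perm_digit (u : nat) (p : {perm 'I_u}) (a : nat) : nat :=
  oapp (fun d : 'I_u => val (p d)) a (insub a).

(* Only the values Sigma r with r >= 1 are used. *)
Definition radical_inverse (R : realType) (u v : nat)
    (Sigma : nat -> {perm 'I_u}) (n : nat) : R :=
  limn (fun m : nat => \sum_(1 <= r < m)
    (perm_digit (Sigma r) (uv_digit u v n%:Z r))%:R / u%:R ^+ r : R).

Definition halton (R : realType) (s : nat) (u v : 'I_s -> nat)
    (Sigma : forall i : 'I_s, nat -> {perm 'I_(u i)}) (n : nat) : 'rV[R]_s :=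
  \row_(i < s) radical_inverse R (v i) (Sigma i) n.

Definition star_discrepancy (R : realType) (s : nat) (x : nat -> 'rV[R]_s)
    (N : nat) : R :=
  sup [set `| #|[pred n : 'I_N | [forall i, x n ord0 i < y ord0 i]]|%:R / N%:R
              - \prod_(i < s) y ord0 i |
      | y in [set y : 'rV[R]_s | forall i, 0 < y ord0 i <= 1]].

(* Main.v *)
(* Write [d_r(n)] for the permuted digits of [n] in base [u_i / v_i]; the first
   [k] of them are determined by, and determine, [n mod u_i ^ k].  Take a box
   whose vertex has coordinates [y_i = sum_r y_i(r) u_i ^ -r] with digits 0 and
   1, and an integer [w] whose digits in every base are those of the vertex.
   Splitting [0, y_i) at the digits 1 of [y_i] cuts the box into elementary
   boxes indexed by tuples [k]; the integers [n] in such a box form a residue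
   class [A_k] modulo [P_k = prod_i u_i ^ k_i], and
     [#{n < e : n = A_k mod P_k} - e / P_k = ({A_k - e} - {A_k}) / P_k],
   where [{.}] is the residue modulo [P_k].  If the digits 1 sit at multiples of
   all [totient(u_i)], at places where
   [delta_i = sigma_(i,r)^-1(0) - sigma_(i,r)^-1(1) mod u_i] does not depend on
   [r] (a positive proportion of the places, by pigeonhole), then
   [{A_k - w} / P_k] is the fractional part of [sum_i delta_i / u_i], whatever
   [k] is.  For [s >= 2] this is not [1 / 2], which is the average over [e] of
   [{A_k - e} / P_k]; hence the local discrepancies at [w] and at some [e] differ
   by a positive multiple of the number of tuples [k], which is of order
   [(log N) ^ s].  When the fractional part is [1 / 2], which forces [s = 1],
   an explicit [e] replaces the averaging. *)

Require Import Defs.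
From HB Require Import structures.
From mathcomp Require Import all_boot all_order perm all_algebra.
From mathcomp Require Import all_classical all_reals all_analysis.
From mathcomp Require Import cyclic.
From mathcomp Require Import zify ring lra.

Set Implicit Arguments.
Unset Strict Implicit.
Unset Printing Implicit Defensive.

Import Order.TTheory GRing.Theory Num.Theory.
Import numFieldNormedType.Exports.

Local Open Scope ring_scope.

(** * Digits of the u/v-adic expansion *)

Lemma PoszX (n k : nat) : (n ^ k)%N%:Z = n%:Z ^+ k.
Proof. by rewrite -!natz natrX. Qed.

Section Digits.
Variables u v : nat.
Hypothesis hu : (1 < u)%N.
Implicit Types z w : int.

Lemma uv_stepE z : u%:Z * uv_step u v z = v%:Z * z - (v%:Z * z %% u%:Z)%Z.
Proof.
rewrite /uv_step mulrC divzK // -eqz_mod_dvd; apply/eqP.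
by rewrite modz_mod.
Qed.

Lemma uv_digitE z r :
  (uv_digit u v z r.+1)%:Z = (v%:Z * uv_state u v z r %% u%:Z)%Z.
Proof. by rewrite /uv_digit /= gez0_abs // modz_ge0 //; lia. Qed.

Lemma uv_digit_lt z r : (uv_digit u v z r < u)%N.
Proof.
have h : ((v%:Z * uv_state u v z r.-1 %% u%:Z)%Z < u%:Z) by apply: ltz_pmod; lia.
have h0 : 0 <= (v%:Z * uv_state u v z r.-1 %% u%:Z)%Z by rewrite modz_ge0 //; lia.
by rewrite /uv_digit; lia.
Qed.

Lemma uv_digit_eq z w r : (uv_digit u v z r.+1 == uv_digit u v w r.+1) =
  (u%:Z %| v%:Z * (uv_state u v z r - uv_state u v w r))%Z.
Proof. by rewrite -eqz_nat !uv_digitE eqz_mod_dvd mulrBr. Qed.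

(** Equal digits cancel in [uv_stepE], so each common digit multiplies the difference of the states
    by [v / u]. *)
Lemma uv_state_diff z w k :
  (forall r, (r < k)%N -> uv_digit u v z r.+1 = uv_digit u v w r.+1) ->
  v%:Z ^+ k * (z - w) = u%:Z ^+ k * (uv_state u v z k - uv_state u v w k).
Proof.
elim: k => [|k IH] h; first by rewrite !expr0.
rewrite exprS -mulrA IH; last by move=> r rk; apply: h; lia.
have /eqP := h k (ltnSn k); rewrite -eqz_nat !uv_digitE => /eqP hk.
rewrite exprSr -mulrA [X in _ = _ * X]mulrBr /uv_state !iterS -/(uv_state u v z k).
rewrite -/(uv_state u v w k) !uv_stepE hk; ring.
Qed.

Hypothesis huv : coprime u v.

Lemma coprimezX k : coprimez (u%:Z ^+ k) (v%:Z ^+ k).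
Proof. by apply/coprimezXl/coprimezXr. Qed.

(** Both directions rest on [uv_state_diff]: coprimality removes [v ^ k]; conversely, cancelling
    [u ^ k] yields the digits one after another. *)
Lemma uv_digits_congr z w k :
  reflect (forall r, (r < k)%N -> uv_digit u v z r.+1 = uv_digit u v w r.+1)
          (u%:Z ^+ k %| z - w)%Z.
Proof.
apply: (iffP idP) => [|h]; last first.
  rewrite -(Gauss_dvdzr _ (coprimezX k)) (uv_state_diff h).
  exact: dvdz_mulr.
elim: k => // k IH hk.
have hd : forall r, (r < k)%N -> uv_digit u v z r.+1 = uv_digit u v w r.+1.
  by apply: IH; apply: dvdz_trans hk; rewrite exprSr dvdz_mulr.
move=> r; rewrite ltnS leq_eqVlt => /orP[/eqP ->|]; last exact: hd.
apply/eqP; rewrite uv_digit_eq.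
have hu0 : u%:Z ^+ k != 0 by rewrite expf_neq0 //; lia.
rewrite -(dvdz_mul2l hu0) mulrCA -(uv_state_diff hd) -exprSr.
by do 2! apply: dvdz_mull.
Qed.

Lemma uv_digit_shift z w k t : z - w = u%:Z ^+ k * t ->
  ((uv_digit u v z k.+1)%:Z = (uv_digit u v w k.+1)%:Z + v%:Z ^+ k.+1 * t
     %[mod u%:Z])%Z.
Proof.
move=> e.
have /uv_state_diff :
    forall r, (r < k)%N -> uv_digit u v z r.+1 = uv_digit u v w r.+1.
  by apply/uv_digits_congr; rewrite e dvdz_mulr.
rewrite e mulrCA => /mulfI h.
have {}h : uv_state u v z k = uv_state u v w k + v%:Z ^+ k * t.
  by rewrite h ?expf_neq0 //; [ring|lia].
rewrite !uv_digitE modz_mod modzDml h mulrDr mulrA exprS //.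
Qed.

End Digits.

(** * Permuted digits and prefixes of digit strings *)

Section PermDigit.
Variables (u : nat) (p : {perm 'I_u}).

Lemma perm_digit_lt a : (perm_digit p a < u)%N = (a < u)%N.
Proof.
rewrite /perm_digit; case: insubP => [d -> _ /=|/negbTE -> //].
by rewrite ltn_ord.
Qed.

Lemma perm_digitK : cancel (perm_digit p) (perm_digit p^-1).
Proof.
move=> a; rewrite {2}/perm_digit; case: insubP => [d _ <- /=|/negbTE h /=].
  by rewrite /perm_digit valK /= permK.
by rewrite /perm_digit insubF.
Qed.
End PermDigit.

Lemma perm_digitKV u (p : {perm 'I_u}) :
  cancel (perm_digit p^-1) (perm_digit p).
Proof. by move=> a; rewrite -{1}(invgK p) perm_digitK. Qed.

(* The value of the digit string [d 1, ..., d k], most significant first. *)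
Fixpoint prefix (u : nat) (d : nat -> nat) (k : nat) : nat :=
  if k is k'.+1 then (u * prefix u d k' + d k)%N else 0%N.

Section Prefix.
Variables (u : nat).
Implicit Types d y : nat -> nat.

Lemma prefix_lt d k : (forall r, (d r < u)%N) -> (prefix u d k < u ^ k)%N.
Proof.
move=> hd; elim: k => //= k IH; rewrite expnS.
have := hd k.+1; nia.
Qed.

Lemma prefixS_eq d y k : (d k.+1 < u)%N -> (y k.+1 < u)%N ->
  (prefix u d k.+1 == prefix u y k.+1) =
  (prefix u d k == prefix u y k) && (d k.+1 == y k.+1).
Proof.
move=> /= hd hy; case: (ltngtP (prefix u d k) (prefix u y k)) => /= h.
- by apply/negbTE; nia.
- by apply/negbTE; nia.
- by rewrite h eqn_add2l.
Qed.

Lemma prefixS_lt d y k : (d k.+1 < u)%N -> (y k.+1 < u)%N ->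
  (prefix u d k.+1 < prefix u y k.+1)%N =
  ((prefix u d k < prefix u y k) ||
   (prefix u d k == prefix u y k) && (d k.+1 < y k.+1))%N.
Proof.
move=> /= hd hy; case: (ltngtP (prefix u d k) (prefix u y k)) => /= h.
- by apply/idP; nia.
- by apply/negbTE; rewrite -leqNgt; nia.
- by rewrite h ltn_add2l.
Qed.

Lemma prefix_eqP d y k : (forall r, (d r < u)%N) -> (forall r, (y r < u)%N) ->
  reflect (forall r, (r < k)%N -> d r.+1 = y r.+1) (prefix u d k == prefix u y k).
Proof.
move=> hd hy; elim: k => [|k IH]; first by apply: (iffP idP).
rewrite prefixS_eq //; apply: (iffP andP) => [[/IH h /eqP e] r|h].
  by rewrite ltnS leq_eqVlt => /orP[/eqP ->//|]; exact: h.
by split; [apply/IH => r rk; apply: h; lia|apply/eqP/h].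
Qed.

(** The first place where the strings differ decides, so at most one summand is 1. For digits 0 and
    1 of [y] this splits the interval below [y] into elementary intervals. *)
Lemma prefix_ltE d y L : (forall r, (d r < u)%N) -> (forall r, (y r < u)%N) ->
  (prefix u d L < prefix u y L)%N =
  (\sum_(j < L) ((prefix u d j == prefix u y j) && (d j.+1 < y j.+1)%N))%N :> nat.
Proof.
move=> hd hy; elim: L => [|L IH]; first by rewrite big_ord0 ltnn.
rewrite big_ord_recr -IH prefixS_lt //.
by case: ltngtP.
Qed.

End Prefix.

Section Scrambled.
Variables (u v : nat) (Sg : nat -> {perm 'I_u}).
Hypothesis hu : (1 < u)%N.

Definition scrambled_digit (n r : nat) : nat :=
  perm_digit (Sg r) (uv_digit u v n%:Z r).

Lemma scrambled_digit_lt n r : (scrambled_digit n r < u)%N.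
Proof. by rewrite perm_digit_lt uv_digit_lt. Qed.

(** The shift modulo [u] of the raw digit that turns a permuted 1 into a permuted 0. *)
Definition digit_gap r : nat :=
  ((perm_digit (Sg r)^-1 0 + (u - perm_digit (Sg r)^-1 1)) %% u)%N.

Lemma digit_gap_lt r : (digit_gap r < u)%N.
Proof. by rewrite ltn_mod; lia. Qed.

Lemma digit_gap_gt0 r : (0 < digit_gap r)%N.
Proof.
have h0 : (perm_digit (Sg r)^-1 0 < u)%N by rewrite perm_digit_lt; lia.
have h1 : (perm_digit (Sg r)^-1 1 < u)%N by rewrite perm_digit_lt.
have ne : perm_digit (Sg r)^-1 0 <> perm_digit (Sg r)^-1 1.
  by move/(can_inj (perm_digitKV _)).
(* The unreduced sum lies strictly between 0 and [2 * u]; a multiple of [u] there is [u] itself,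
   which would make the two preimages equal. *)
rewrite lt0n; apply/negP => /eqP/eqP; rewrite -/(_ %| _)%N => /dvdnP[q e].
have : q = 1%N by nia.
by nia.
Qed.

Hypothesis huv : coprime u v.

Lemma scrambled_prefix_eq n w k :
  (prefix u (scrambled_digit n) k == prefix u (scrambled_digit w) k) =
  (u%:Z ^+ k %| n%:Z - w%:Z)%Z.
Proof.
apply/prefix_eqP/(uv_digits_congr hu huv) => [||h r rk|h r rk];
  try exact: scrambled_digit_lt.
- exact: (can_inj (perm_digitK _) (h r rk)).
- by rewrite /scrambled_digit h.
Qed.

(** On [n < u ^ k] the prefix map is injective by [scrambled_prefix_eq], and it maps into a set of
    the same size. *)
Lemma scrambled_prefix_surj k c : (c < u ^ k)%N ->
  exists n, prefix u (scrambled_digit n) k = c.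
Proof.
move=> hc.
have lt n : (prefix u (scrambled_digit n) k < u ^ k)%N.
  by apply/prefix_lt/scrambled_digit_lt.
pose f (n : 'I_(u ^ k)) := Ordinal (lt n).
have finj : injective f.
  move=> a b /(congr1 val) /= /eqP; rewrite scrambled_prefix_eq -eqz_mod_dvd -PoszX.
  rewrite !modz_nat eqz_nat !modn_small // => /eqP; exact: val_inj.
exists (invF finj (Ordinal hc)).
by rewrite -[LHS]/(val (f _)) f_invF.
Qed.

(* [v ^ k.+1 = 1 %[mod u]] removes the factor [v ^ k.+1] by which a shift by
   [u ^ k * t] moves the digit [k.+1]. *)
Lemma scrambled_digit_zero n w k : (v ^ k.+1 = 1 %[mod u])%N ->
  scrambled_digit w k.+1 = 1%N ->
  (prefix u (scrambled_digit n) k == prefix u (scrambled_digit w) k)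
    && (scrambled_digit n k.+1 == 0%N) =
  (u%:Z ^+ k.+1 %| n%:Z - (w + digit_gap k.+1 * u ^ k)%N%:Z)%Z.
Proof.
move=> hv hw; rewrite scrambled_prefix_eq.
have hu0 : u%:Z ^+ k != 0 by rewrite expf_neq0 //; lia.
case: (boolP (u%:Z ^+ k %| n%:Z - w%:Z)%Z) => [/dvdzP[t]|h] /=; last first.
  symmetry; apply/negbTE; apply: contra h.
  rewrite exprSr => /(dvdz_trans (dvdz_mulr _ (dvdzz _))).
  by rewrite PoszD PoszM PoszX opprD addrA rpredBr // dvdz_mull.
rewrite mulrC => e.
rewrite PoszD PoszM PoszX opprD addrA e [_%:Z * _]mulrC -mulrBr exprSr dvdz_mul2l //.
have := uv_digit_shift hu huv e.
rewrite -[X in X = _ -> _]modz_mod.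
have -> : (uv_digit u v n k.+1)%:Z = (perm_digit (Sg k.+1)^-1 (scrambled_digit n k.+1))%:Z.
  by rewrite /scrambled_digit perm_digitK.
have -> : (uv_digit u v w k.+1)%:Z = (perm_digit (Sg k.+1)^-1 1)%:Z.
  by rewrite -hw /scrambled_digit perm_digitK.
have hx : (perm_digit (Sg k.+1)^-1 (scrambled_digit n k.+1) < u)%N.
  by rewrite perm_digit_lt scrambled_digit_lt.
have h0 : (perm_digit (Sg k.+1)^-1 0 < u)%N by rewrite perm_digit_lt; lia.
have h1 : (perm_digit (Sg k.+1)^-1 1 < u)%N by rewrite perm_digit_lt.
have -> : (scrambled_digit n k.+1 == 0%N) =
   (perm_digit (Sg k.+1)^-1 (scrambled_digit n k.+1) == perm_digit (Sg k.+1)^-1 0).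
  by rewrite (can_eq (perm_digitKV _)).
rewrite /digit_gap.
move: (perm_digit _ _) (perm_digit _ 0%N) (perm_digit _ 1%N) hx h0 h1 => x a0 a1 hx h0 h1.
rewrite modz_mod -modzDmr -modzMml -PoszX [((v ^ _)%N %% _)%Z]modz_nat hv.
rewrite -modz_nat modzMml mul1r modzDmr => /eqP.
rewrite eqz_mod_dvd => h.
rewrite -modz_nat -eqz_mod_dvd modz_mod eqz_mod_dvd PoszD -subzn; last lia.
(* By [h] the last two terms are multiples of [u], which leaves [x = a0] modulo [u], with both below
   [u]. *)
have -> : t - (a0%:Z + (u%:Z - a1%:Z)) = x%:Z - a0%:Z - (x%:Z - (a1%:Z + t)) - u%:Z by ring.
rewrite rpredBr // rpredBr // -eqz_mod_dvd !modz_nat eqz_nat !modn_small //.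
Qed.

End Scrambled.

(** * The radical inverse function *)

Lemma prefix_mono u d k m : (forall r, (d r < u)%N) -> (k <= m)%N ->
  (prefix u d k * u ^ (m - k) <= prefix u d m < (prefix u d k).+1 * u ^ (m - k))%N.
Proof.
move=> hd; elim: m => [|m IH].
  by rewrite leqn0 => /eqP->; rewrite subnn expn0 !muln1 leqnn ltnSn.
rewrite leq_eqVlt => /orP[/eqP->|]; first by rewrite subnn expn0 !muln1 leqnn ltnSn.
rewrite ltnS => km; rewrite subSn // expnS /= !(mulnCA _ u).
have /andP[h1 h2] := IH km; have := hd m.+1; nia.
Qed.

Lemma sum_digits_prefix (R : realType) u (d : nat -> nat) k : (1 < u)%N ->
  \sum_(1 <= r < k.+1) (d r)%:R / u%:R ^+ r = (prefix u d k)%:R / u%:R ^+ k :> R.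
Proof.
move=> hu.
have u0 : u%:R != 0 :> R by rewrite pnatr_eq0; lia.
elim: k => [|k IH]; first by rewrite big_geq // mul0r.
rewrite big_nat_recr //= IH natrD natrM exprS.
by field; rewrite u0 expf_neq0.
Qed.

Section RadicalInverse.
Variables (R : realType) (u v : nat) (Sg : nat -> {perm 'I_u}).
Hypotheses (hu : (1 < u)%N) (huv : coprime u v).
Local Notation D := (scrambled_digit v Sg).
Local Notation phi := (radical_inverse R v Sg).

(** The partial sums increase and stay in the closed elementary interval of the first [k] digits, so
    they converge to a point of it. A tail of maximal digits reaches the right end, hence the
    non-strict upper bound. *)
Lemma radical_inverse_bounds n k :
  (prefix u (D n) k)%:R / u%:R ^+ k <= phi n <= (prefix u (D n) k).+1%:R / u%:R ^+ k.
Proof.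
have u0 : 0 < u%:R :> R by rewrite ltr0n; lia.
have hd := @scrambled_digit_lt u v Sg hu n.
pose S m : R := \sum_(1 <= r < m) (D n r)%:R / u%:R ^+ r.
have ndS : nondecreasing_seq S.
  apply/nondecreasing_seqP => -[|m]; first by rewrite /S !big_geq.
  by rewrite /S [leRHS]big_nat_recr //= lerDl divr_ge0 // exprn_ge0 // ltW.
have ubS k' m : S m <= (prefix u (D n) k').+1%:R / u%:R ^+ k'.
  have [km|mk] := leqP k'.+1 m; last first.
    apply: (le_trans (ndS _ _ (ltnW mk))).
    rewrite /S sum_digits_prefix // ler_pM2r ?invr_gt0 ?exprn_gt0 //.
    by rewrite ler_nat.
  case: m km => // m; rewrite ltnS => km; rewrite /S sum_digits_prefix //.
  rewrite ler_pdivrMr ?exprn_gt0 // mulrAC ler_pdivlMr ?exprn_gt0 //.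
  rewrite -!natrX -!natrM ler_nat.
  have /andP[_] := prefix_mono hd km.
  have -> : (u ^ m = u ^ (m - k') * u ^ k')%N by rewrite -expnD subnK.
  set a := prefix _ _ m; set b := prefix _ _ k'.
  by move=> h; rewrite mulnA leq_mul2r; apply/orP; right; apply: ltnW.
have cS : cvgn S.
  apply: nondecreasing_is_cvgn => //.
  by exists ((prefix u (D n) k).+1%:R / u%:R ^+ k) => _ [m _ <-]; exact: ubS.
apply/andP; split.
  rewrite -sum_digits_prefix // -/(S k.+1); exact: nondecreasing_cvgn_le.
by apply: limr_le => //; apply: nearW => m; exact: ubS.
Qed.

Lemma prefix_lt_of_radical_inverse_lt (y : nat -> nat) L n :
  phi n < (prefix u y L)%:R / u%:R ^+ L -> (prefix u (D n) L < prefix u y L)%N.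
Proof.
have u0 : 0 < u%:R :> R by rewrite ltr0n; lia.
rewrite ltnNge => h; apply/negP => le; move: h; apply/negP; rewrite -leNgt.
have /andP[h _] := radical_inverse_bounds n L; apply: le_trans h.
by rewrite ler_pM2r ?invr_gt0 ?exprn_gt0 // ler_nat.
Qed.

(* Such an [n] has [phi n] equal to the boundary value, approached from below,
   which determines all of its digits. *)
Lemma radical_inverse_boundary_unique (y : nat -> nat) L n w :
  (prefix u (D n) L < prefix u y L)%N -> (prefix u (D w) L < prefix u y L)%N ->
  (prefix u y L)%:R / u%:R ^+ L <= phi n -> (prefix u y L)%:R / u%:R ^+ L <= phi w ->
  n = w.
Proof.
have u0 : 0 < u%:R :> R by rewrite ltr0n; lia.
have key x k : (L <= k)%N -> (prefix u (D x) L < prefix u y L)%N ->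
    (prefix u y L)%:R / u%:R ^+ L <= phi x ->
    (prefix u (D x) k).+1 = (prefix u y L * u ^ (k - L))%N.
  move=> Lk lt le; apply/eqP; rewrite eqn_leq; apply/andP; split.
    have /andP[_ h] := prefix_mono (@scrambled_digit_lt u v Sg hu x) Lk.
    by apply: leq_trans h _; rewrite leq_mul2r lt orbT.
  have /andP[_ h] := radical_inverse_bounds x k.
  have := le_trans le h.
  rewrite ler_pdivrMr ?exprn_gt0 // mulrAC ler_pdivlMr ?exprn_gt0 //.
  rewrite -!natrX -!natrM ler_nat.
  have -> : (u ^ k = u ^ (k - L) * u ^ L)%N by rewrite -expnD subnK.
  rewrite mulnA leq_pmul2r //.
  by rewrite expn_gt0; lia.
move=> ltn ltw len lew.
(* Large enough that [n] and [w] are below [u ^ k], so that congruence modulo [u ^ k] is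
   equality. *)
pose k := (L + n + w)%N.
have kL : (L <= k)%N by rewrite /k; lia.
have : prefix u (D n) k == prefix u (D w) k.
  by rewrite -eqSS (key n) // (key w).
rewrite (scrambled_prefix_eq Sg hu huv) -eqz_mod_dvd -PoszX !modz_nat eqz_nat.
have hk : (k < u ^ k)%N by exact: ltn_expl.
by rewrite !modn_small; [move/eqP| rewrite /k in hk *; lia ..].
Qed.

End RadicalInverse.

(** * Counting in residue classes *)

Lemma modz_eq (x q r : int) (P : nat) : x = q * P%:Z + r -> 0 <= r < P%:Z ->
  (x %% P%:Z)%Z = r.
Proof. by move=> -> h; rewrite modzMDl modz_small // -[`|_|%N]/P; lia. Qed.

(** When [e] grows by 1 the residue of [A - e] drops by 1, except that it jumps from 0 to [P - 1]
    exactly when [e] is counted. *)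
Lemma count_residueE (A : int) (P e : nat) : (0 < P)%N ->
  (\sum_(n < e) (P%:Z %| (n%:Z - A)%R)%Z)%N%:Z * P%:Z =
  e%:Z + ((A - e%:Z) %% P%:Z)%Z - (A %% P%:Z)%Z.
Proof.
move=> P0; elim: e => [|e IH]; first by rewrite big_ord0 subr0; ring.
rewrite big_ord_recr /= PoszD mulrDl IH.
set x := A - e%:Z.
suff : (P%:Z %| e%:Z - A)%Z%:Z * P%:Z =
    1 + ((x - 1) %% P%:Z)%Z - (x %% P%:Z)%Z.
  by rewrite (_ : A - e.+1%:Z = x - 1) /x; lia.
have -> : (P%:Z %| e%:Z - A)%Z = (P%:Z %| x)%Z by rewrite -(opprB A) !dvdzE abszN.
have e1 := divz_eq x P%:Z; set q := (x %/ P%:Z)%Z in e1.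
have h0 : 0 <= (x %% P%:Z)%Z by rewrite modz_ge0; lia.
have hP : (x %% P%:Z)%Z < P%:Z by apply: ltz_pmod; lia.
have [e0|n0] := eqVneq (x %% P%:Z)%Z 0.
  rewrite (introT dvdz_mod0P e0).
  by rewrite (@modz_eq (x - 1) (q - 1) (P%:Z - 1)); lia.
rewrite (introF dvdz_mod0P (elimN eqP n0)).
by rewrite (@modz_eq (x - 1) q ((x %% P%:Z)%Z - 1)); lia.
Qed.

(** Over full periods the sum does not depend on [B]. Two copies, one reversed, pair the residues of
    [e] and [-1 - e], which add up to [P - 1]. *)
Lemma sum_modz (B : int) (P M : nat) : (0 < P)%N -> (P %| M)%N ->
  2 * \sum_(e < M) ((B - e%:Z) %% P%:Z)%Z = M%:Z * (P%:Z - 1).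
Proof.
move=> P0 PM; pose S B := \sum_(e < M) ((B - e%:Z) %% P%:Z)%Z.
have Sstep C : S (C + 1) = S C.
  rewrite /S; case: M PM {S} => [|M] PM; first by rewrite !big_ord0.
  rewrite big_ord_recl big_ord_recr /= subr0 [LHS]addrC; congr (_ + _).
    by apply: eq_bigr => i _; congr modz; rewrite /bump; lia.
  have /dvdnP[q e] := PM.
  rewrite (_ : C + 1 = q%:Z * P%:Z + (C - M%:Z)); last by lia.
  by rewrite modzMDl.
have SC C : S C = S 0.
  by elim/int_rec: C => // n IH; [rewrite -addn1 PoszD Sstep IH|
    rewrite -(Sstep (- _)) -IH; congr S; lia].
have Srev : S (-1) = \sum_(e < M) ((0 + e%:Z) %% P%:Z)%Z.
  rewrite (SC (-1)) -(SC (M%:Z - 1)) /S (reindex_inj rev_ord_inj) /=.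
  by apply: eq_bigr => i _; congr modz; have := ltn_ord i; lia.
rewrite -/(S B) (SC B) mulrDl mul1r -{1}(SC (-1)) Srev -(SC (-1)) /S -big_split /=.
rewrite (eq_bigr (fun=> P%:Z - 1)) => [|i _].
  by rewrite sumr_const card_ord -mulr_natl natz.
have e1 := divz_eq i%:Z P%:Z.
have h0 : 0 <= (i%:Z %% P%:Z)%Z by rewrite modz_ge0; lia.
have hP : (i%:Z %% P%:Z)%Z < P%:Z by apply: ltz_pmod; lia.
rewrite add0r.
rewrite (@modz_eq (-1 - i%:Z) (- (i%:Z %/ P%:Z)%Z - 1) (P%:Z - 1 - (i%:Z %% P%:Z)%Z)); lia.
Qed.

Lemma expn_prod (I : finType) (F : I -> nat) k :
  ((\prod_i F i) ^ k = \prod_i F i ^ k)%N.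
Proof. exact: (big_morph (expn^~ k) (fun a b => expnMn a b k) (exp1n k)). Qed.

(** * Pairwise coprime moduli *)

Section Coprime.
Variables (s : nat) (f : 'I_s -> nat).
Hypothesis cf : forall i j, i != j -> coprime (f i) (f j).

Lemma coprime_prodr (I : Type) (r : seq I) (Q : pred I) (F : I -> nat) a :
  (forall i, Q i -> coprime a (F i)) -> coprime a (\prod_(i <- r | Q i) F i).
Proof.
move=> h; apply: (big_ind (fun x => coprime a x)) => //; first exact: coprimen1.
by move=> x y hx hy; rewrite coprimeMr hx.
Qed.

Lemma prod_dvdn x : (\prod_(i < s) f i %| x)%N = [forall i, (f i %| x)%N].
Proof.
apply/idP/forallP => [h i|h].
  by apply: dvdn_trans h; rewrite (bigD1 i) //= dvdn_mulr.
suff : forall r : seq 'I_s, uniq r -> (\prod_(i <- r) f i %| x)%N.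
  by move/(_ _ (index_enum_uniq _)).
elim=> [|a r IH] /=; first by rewrite big_nil dvd1n.
move=> /andP[ar ur]; rewrite big_cons Gauss_dvd ?h ?IH //.
rewrite big_seq; apply: coprime_prodr => i ir; apply: cf.
by apply: contraNneq ar => ->.
Qed.

Lemma prod_dvdz (x : int) :
  ((\prod_(i < s) f i)%N%:Z %| x)%Z = [forall i, ((f i)%:Z %| x)%Z].
Proof. by rewrite dvdzE prod_dvdn. Qed.

Lemma chinese_remainder_family (a : 'I_s -> nat) : (forall i, (0 < f i)%N) ->
  exists2 w, (w < \prod_(i < s) f i)%N & forall i, (w = a i %[mod f i])%N.
Proof.
(* By Euler's theorem [c i] is 1 modulo [f i]; it is 0 modulo every other [f j]. *)
move=> f0; pose c i := ((\prod_(j < s | j != i) f j) ^ totient (f i))%N.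
have P0 : (0 < \prod_(i < s) f i)%N by apply: prodn_gt0.
exists ((\sum_i a i * c i) %% \prod_(i < s) f i)%N; first by rewrite ltn_mod.
move=> i; rewrite modn_dvdm; last by rewrite (bigD1 i) //= dvdn_mulr.
rewrite (bigD1 i) //= -modnDm -modnMmr Euler_exp_totient; last first.
  by rewrite coprime_sym; apply: coprime_prodr => j ji; rewrite cf // eq_sym.
rewrite modnMmr muln1 (eqP (_ : f i %| \sum_(j < s | j != i) a j * c j)%N) ?addn0 ?modn_mod //.
apply: dvdn_sum => j ji; apply: dvdn_mull; rewrite /c.
have t0 : (0 < totient (f j))%N by rewrite totient_gt0.
rewrite -(prednK t0) expnS dvdn_mulr // (bigD1 i) 1?eq_sym //= dvdn_mulr //.
Qed.

End Coprime.

(** In base [u] the sum has digits 1 at the even places and 0 at the odd ones; [h] is its residue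
    modulo [u ^ (2 * j)], with leading digit at place [2 * j - 2]. *)
Lemma sum_sqr_powers (u m j : nat) : (1 < u)%N -> (0 < j)%N -> (j <= m)%N ->
  exists2 h, (u ^ (2 * j).-2 <= h < u ^ (2 * j).-1)%N &
    exists q, (\sum_(i < m) u ^ (2 * i) = q * u ^ (2 * j) + h)%N.
Proof.
move=> hu j0; elim: m => [|m IH]; first by rewrite leqn0; lia.
have lt n : (\sum_(i < n.+1) u ^ (2 * i) < u ^ (2 * n.+1).-1)%N.
  elim: n => [|n IHn]; first by rewrite big_ord1 expn1.
  have -> : (\sum_(i < n.+2) u ^ (2 * i) =
      \sum_(i < n.+1) u ^ (2 * i) + u ^ (2 * n.+1))%N by rewrite big_ord_recr.
  rewrite (_ : (2 * n.+2).-1 = (2 * n.+1).+1)%N; last by lia.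
  rewrite expnS; have : (u ^ (2 * n.+1).-1 * 2 <= u ^ (2 * n.+1))%N.
    rewrite -[X in (_ <= u ^ X)%N]prednK // expnSr leq_mul2l hu orbT //.
  have : (u ^ (2 * n.+1) * 2 <= u * u ^ (2 * n.+1))%N by rewrite mulnC leq_mul2r hu orbT.
  by lia.
rewrite leq_eqVlt => /orP[/eqP ej|jm].
  exists (\sum_(i < m.+1) u ^ (2 * i))%N; last by exists 0%N; rewrite mul0n.
  by rewrite ej lt andbT big_ord_recr /= (_ : (2 * m.+1).-2 = 2 * m)%N ?leq_addl //; lia.
have [h hh [q e]] := IH jm; exists h => //.
exists (q + u ^ (2 * (m - j)))%N; rewrite big_ord_recr /= e mulnDl -expnD.
rewrite (_ : 2 * (m - j) + 2 * j = 2 * m)%N; lia.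
Qed.

(** * Variation of the local discrepancy *)

Section Variation.
Variables (s : nat) (u delta : 'I_s -> nat).
Hypothesis hu : forall i, (1 < u i)%N.
Hypothesis huu : forall i j, i != j -> coprime (u i) (u j).

Local Notation U := (\prod_(i < s) u i)%N.
Local Notation rprod k := (\prod_(i < s) u i ^ k i)%N.
Local Notation pprod k := (\prod_(i < s) u i ^ (k i).+1)%N.

(* [Theta / U] is the sum of the fractions [delta i / u i]. *)
Definition Theta : nat := (\sum_(i < s) delta i * \prod_(j < s | j != i) u j)%N.

Lemma pprodE (k : 'I_s -> nat) : pprod k = (rprod k * U)%N.
Proof. by rewrite -big_split /=; apply: eq_bigr => i _; rewrite expnSr. Qed.

Lemma prod_base_gt0 : (0 < U)%N.
Proof. by apply: prodn_gt0 => i; have := hu i; lia. Qed.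

Lemma rprod_gt0 (k : 'I_s -> nat) : (0 < rprod k)%N.
Proof. by apply: prodn_gt0 => i; rewrite expn_gt0; have := hu i; lia. Qed.

Lemma pprod_gt0 (k : 'I_s -> nat) : (0 < pprod k)%N.
Proof. by apply: prodn_gt0 => i; rewrite expn_gt0; have := hu i; lia. Qed.

(** Summands of [Theta] with index other than [i] contain one more factor [u i] and vanish; in the
    remaining one the foreign powers are 1 modulo [u i]. Thus one number realizes the digit shifts
    of all bases at once. *)
Lemma rprod_Theta_mod (k : 'I_s -> nat) i :
  (forall j, j != i -> u j ^ (k j).+1 = 1 %[mod u i])%N ->
  (rprod k * Theta = delta i * u i ^ k i %[mod u i ^ (k i).+1])%N.
Proof.
move=> h; rewrite /Theta big_distrr (bigD1 i) //= -modnDmr.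
rewrite (eqP (_ : u i ^ (k i).+1 %| \sum_(j < s | j != i) _)%N) ?addn0; last first.
  apply: dvdn_sum => j ji; rewrite mulnCA; apply: dvdn_mull.
  rewrite (bigD1 i) //= [X in (_ * X)%N](bigD1 i) 1?eq_sym //= mulnACA.
  by rewrite -expnSr dvdn_mulr.
rewrite mulnCA [X in (_ * (X * _))%N](bigD1 i) //= -mulnA -big_split /=.
rewrite expnSr mulnCA [in RHS]mulnC -!muln_modr; congr (_ * _)%N.
rewrite -modnMmr; suff -> : (\prod_(j < s | j != i) (u j ^ k j * u j) = 1 %[mod u i])%N.
  by rewrite modnMmr muln1.
apply: (big_ind (fun x => x = 1 %[mod u i])%N) => // [x y hx hy|j ji].
  by rewrite -modnMm hx hy modnMm.
by rewrite -expnSr h.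
Qed.

(** Reducing [2 * Theta] modulo [u i] gives [u i %| 2 * delta i], and the bounds on [delta i] force
    [u i = 2 * delta i]. *)
Lemma Theta_half_even i : (0 < delta i < u i)%N ->
  (2 * (Theta %% U) = U)%N -> (2 %| u i)%N.
Proof.
move=> hd e.
have uU : (u i %| U)%N by rewrite (bigD1 i) //= dvdn_mulr.
have : (u i %| 2 * Theta)%N.
  by rewrite (divn_eq Theta U) mulnDr e dvdn_add // mulnA dvdn_mull.
rewrite /Theta (bigD1 i) //= mulnDr dvdn_addl; last first.
  apply/dvdn_mull/dvdn_sum => j ji; apply: dvdn_mull.
  by rewrite (bigD1 i) 1?eq_sym //= dvdn_mulr.
rewrite mulnA Gauss_dvdl; last by apply: coprime_prodr => j ji; rewrite huu // eq_sym.
move=> /dvdnP[q eq]; have q1 : q = 1%N by nia.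
by move: eq; rewrite q1 mul1n => <-; exact: dvdn_mulr.
Qed.

Variable R : realType.

(** This is the difference of the local discrepancies at [e] and at [w], as [local_discrepancy_diff]
    shows. *)
Definition variation (L : nat) (F : {set {ffun 'I_s -> 'I_L}}) (w e : nat) : R :=
  \sum_(k in F) ((((w + rprod k * Theta)%N%:Z - e%:Z) %% (pprod k)%:Z)%Z
                 - ((rprod k * Theta)%N%:Z %% (pprod k)%:Z)%Z)%:~R / (pprod k)%:R.

Lemma rprod_Theta_frac (k : 'I_s -> nat) :
  ((rprod k * Theta)%N%:Z %% (pprod k)%:Z)%Z%:~R / (pprod k)%:R =
  (Theta %% U)%N%:R / U%:R :> R.
Proof.
rewrite modz_nat pprodE -muln_modr -pmulrn !natrM.
have r0 : (rprod k)%:R != 0 :> R by rewrite pnatr_eq0 -lt0n rprod_gt0.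
have u0 : U%:R != 0 :> R by rewrite pnatr_eq0 -lt0n prod_base_gt0.
by field; rewrite r0 u0.
Qed.

(* Over a full period [e < U ^ L] the first residue is equidistributed. *)
Lemma variation_average (L : nat) (F : {set {ffun 'I_s -> 'I_L}}) w :
  (0 < s)%N -> (2 * (Theta %% U) != U)%N ->
  (forall k, k \in F -> forall i, (0 < k i)%N) ->
  exists2 e, (e < U ^ L)%N & #|F|%:R / (4 * U%:R) <= `|variation F w e|.
Proof.
move=> s0 ne kF.
have U0 := prod_base_gt0.
have UR : 0 < U%:R :> R by rewrite ltr0n.
have [/eqP F0|F0] := posnP #|F|.
  by exists 0%N; rewrite ?expn_gt0 ?U0 // (eqP F0) mul0r.
pose M := (U ^ L)%N; have M0 : (0 < M)%N by rewrite expn_gt0 U0.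
(* The mean over [e] of the summand of index [k]. *)
pose c (k : {ffun 'I_s -> 'I_L}) : R :=
  ((pprod k)%:R - 1) / (2 * (pprod k)%:R) - (Theta %% U)%N%:R / U%:R.
have PM (k : {ffun 'I_s -> 'I_L}) : (pprod k %| M)%N.
  rewrite /M expn_prod prod_dvdn; last first.
    by move=> i j ij; rewrite coprimeXl ?coprimeXr ?huu.
  by apply/forallP => i; rewrite (bigD1 i) //= dvdn_mulr // dvdn_exp2l.
have sumV : \sum_(e < M) variation F w e = M%:R * \sum_(k in F) c k.
  rewrite exchange_big mulr_sumr; apply: eq_bigr => k _.
  have P0 : 0 < (pprod k)%:R :> R by rewrite ltr0n pprod_gt0.
  under eq_bigr do rewrite rmorphB mulrBl rprod_Theta_frac.
  rewrite sumrB sumr_const card_ord -mulr_suml /c mulrBr.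
  congr (_ - _); last exact/esym/mulr_natl.
  rewrite -rmorph_sum /=.
  have /(congr1 (fun x : int => x%:~R : R)) :=
    sum_modz (w + rprod k * Theta)%N%:Z (pprod_gt0 (fun i => k i)) (PM k).
  rewrite !rmorphM /= rmorphB /= -!pmulrn; set X := (\sum_(e < M) _)%:~R => h.
  have -> : X = M%:R * ((pprod k)%:R - 1) / 2 by lra.
  by field; rewrite gt_eqF.
have cF : #|F|%:R / (4 * U%:R) <= `|\sum_(k in F) c k|.
  (* A positive [k i] makes the modulus at least [2 * U], so the mean residue fraction is within
     [1 / (4 * U)] of one half. *)
  have invP (k : {ffun 'I_s -> 'I_L}) : k \in F ->
      (1 / 2 - 1 / (4 * U%:R) : R) <= ((pprod k)%:R - 1) / (2 * (pprod k)%:R) <= (1 / 2 : R).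
    move=> kFk; have P0 : 0 < (pprod k)%:R :> R by rewrite ltr0n pprod_gt0.
    have r2 : (2 <= rprod k)%N.
      rewrite (bigD1 (Ordinal s0)) //= -[2%N]muln1 leq_mul //.
        exact: leq_ltn_trans (kF _ kFk _) (ltn_expl _ (hu _)).
      by apply: prodn_gt0 => i; rewrite expn_gt0; have := hu i; lia.
    have P2 : 2 * U%:R <= (pprod k)%:R :> R.
      by rewrite -natrM ler_nat pprodE leq_mul2r r2 orbT.
    have -> : ((pprod k)%:R - 1) / (2 * (pprod k)%:R) = 1 / 2 - 1 / (2 * (pprod k)%:R) :> R.
      by field; rewrite gt_eqF.
    have a0 : 0 <= 1 / (2 * (pprod k)%:R) :> R by rewrite divr_ge0 // mulr_ge0.
    have : 1 / (2 * (pprod k)%:R) <= 1 / (4 * U%:R) :> R.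
      by rewrite ler_pdivrMr ?mulr_gt0 // mulrAC ler_pdivlMr ?mulr_gt0 //; lra.
    by move=> a1; apply/andP; split; lra.
  have t2 : #|F|%:R / (4 * U%:R) = \sum_(k in F) (1 / (4 * U%:R)) :> R.
    by rewrite sumr_const -mulr_natl; field; rewrite gt_eqF.
  (* By integrality [(Theta %% U) / U] is at least [1 / (2 * U)] away from one half, always on the
     same side, so all [c k] have one sign and cannot cancel. *)
  have [lt|gt] : (2 * (Theta %% U) < U \/ U < 2 * (Theta %% U))%N by lia.
    have tU : (Theta %% U)%N%:R / U%:R <= 1 / 2 - 1 / (2 * U%:R) :> R.
      rewrite (_ : 1 / 2 - 1 / (2 * U%:R) = (U%:R - 1) / 2 / U%:R); last first.
        by field; rewrite gt_eqF.
      rewrite ler_pM2r ?invr_gt0 //; move: lt; rewrite -(ler_nat R) -natr1 natrM; lra.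
    apply: le_trans (ler_norm _); rewrite t2; apply: ler_sum => k kFk.
    have /andP[h _] := invP k kFk; rewrite /c.
    have -> : 1 / (4 * U%:R) = 1 / (2 * U%:R) - 1 / (4 * U%:R) :> R by field; rewrite gt_eqF.
    lra.
  have tU : 1 / 2 + 1 / (2 * U%:R) <= (Theta %% U)%N%:R / U%:R :> R.
    rewrite (_ : 1 / 2 + 1 / (2 * U%:R) = (U%:R + 1) / 2 / U%:R); last first.
      by field; rewrite gt_eqF.
    rewrite ler_pM2r ?invr_gt0 //; move: gt; rewrite -(ler_nat R) -natr1 natrM; lra.
  rewrite -normrN; apply: le_trans (ler_norm _); rewrite t2 -sumrN; apply: ler_sum => k kFk.
  have /andP[_ h] := invP k kFk; rewrite /c.
  have : 1 / (4 * U%:R) <= 1 / (2 * U%:R) :> R.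
    by rewrite ler_pdivrMr ?mulr_gt0 // mulrAC ler_pdivlMr ?mulr_gt0 //; lra.
  lra.
have [/existsP[e he]|/existsPn none] :=
    boolP [exists e : 'I_M, #|F|%:R / (4 * U%:R) <= `|variation F w e|].
  by exists e.
have : `|\sum_(e < M) variation F w e| < M%:R * (#|F|%:R / (4 * U%:R)).
  apply: le_lt_trans (ler_norm_sum _ _ _) _.
  rewrite -[M in M%:R]card_ord mulr_natl -sumr_const.
  apply: ltr_sum => [|e _]; last by rewrite ltNge none.
  by apply/hasP; exists (Ordinal M0); rewrite ?mem_index_enum.
by rewrite sumV normrM normr_nat ltr_pM2l ?ltr0n // ltNge cF.
Qed.

End Variation.

(* If [Theta = U / 2] then averaging gives nothing; subtracting from [w] a number
   whose base-[u] digits alternate between 0 and 1 does. *)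
Lemma variation_single (R : realType) (u delta : 'I_1 -> nat) (m : nat)
    (F : {set {ffun 'I_1 -> 'I_(2 * m)}}) (w : nat) :
  (1 < u ord0)%N -> (delta ord0 < u ord0)%N ->
  (forall k, k \in F -> forall i, 2 %| (k i).+1)%N ->
  exists2 e, (e < (\prod_(i < 1) u i) ^ (2 * m))%N &
    #|F|%:R / (\prod_(i < 1) u i)%N%:R ^+ 2 <= `|variation u delta R F w e|.
Proof.
rewrite big_ord1; set b := u ord0; set d := delta ord0 => hu hd kF.
have b0 : 0 < b%:R :> R by rewrite ltr0n; lia.
pose M := (b ^ (2 * m))%N.
pose h := (\sum_(i < m) b ^ (2 * i))%N.
pose x := ((w%:Z - h%:Z) %% M%:Z)%Z.
have M0 : (0 < M)%N by rewrite expn_gt0; lia.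
have x0 : 0 <= x by rewrite modz_ge0; lia.
have xM : x < M%:Z by apply: ltz_pmod; lia.
exists `|x|%N; first by rewrite -/M; lia.
apply: le_trans (ler_norm _).
have -> : #|F|%:R / b%:R ^+ 2 = \sum_(k in F) 1 / b%:R ^+ 2 :> R.
  by rewrite sumr_const mul1r mulr_natl.
apply: ler_sum => k kFk; rewrite /Theta !big_ord1 big_pred0 ?muln1; last first.
  by move=> j; rewrite ord1.
rewrite -/b -/d; set K := k ord0 : nat.
have K2 : (2 %| K.+1)%N := kF _ kFk ord0.
have KL : (K < 2 * m)%N by exact: ltn_ord.
have /dvdnP[j ej] := K2.
have [||h' /andP[h1 h2] [q e]] := @sum_sqr_powers b m j hu; [lia|lia|].
have {}ej : (2 * j = K.+1)%N by lia.
rewrite -/h ej /= in h1 h2 e.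
(* Modulo [b ^ K.+1] the difference [w - x] is [h']. Since [h' < b ^ K], adding [d * b ^ K] causes
   no reduction, and exactly [h' >= b ^ K.-1] survives in the summand. *)
have hdb : (d * b ^ K + b ^ K <= b ^ K.+1)%N by rewrite expnS -mulSnr leq_mul2r hd orbT.
have eM : M%:Z = (b ^ (2 * m - K.+1))%N%:Z * (b ^ K.+1)%N%:Z.
  by rewrite -PoszM -expnD subnK.
have xe := divz_eq (w%:Z - h%:Z) M%:Z; rewrite -/x in xe.
set Q := ((w%:Z - h%:Z) %/ M%:Z)%Z in xe.
rewrite (@modz_eq _ (Q * (b ^ (2 * m - K.+1))%N%:Z + q%:Z) (d * b ^ K + h')%N%:Z); first last.
- by lia.
- rewrite gez0_abs // mulrDl -mulrA -eM mulnC; lia.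
rewrite modz_nat modn_small; last by rewrite mulnC; lia.
rewrite PoszD mulnC addrC addKr -pmulrn.
rewrite ler_pdivrMr ?exprn_gt0 // mulrAC ler_pdivlMr -?natrX ?ltr0n ?expn_gt0 ?(ltnW hu) //.
rewrite mul1r -natrM ler_nat.
apply: leq_trans (leq_mul h1 (leqnn _)); rewrite -expnD leq_exp2l //; lia.
Qed.

(** Averaging fails only if every base is even, which coprimality allows only for [s = 1]. The
    constant [4 * U ^ 2] dominates those of both cases. *)
Lemma variation_large (R : realType) (s : nat) (u delta : 'I_s -> nat) (L : nat)
    (F : {set {ffun 'I_s -> 'I_L}}) (w : nat) : (0 < s)%N -> (2 %| L)%N ->
  (forall i, 1 < u i)%N -> (forall i j, i != j -> coprime (u i) (u j)) ->
  (forall i, 0 < delta i < u i)%N ->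
  (forall k, k \in F -> forall i, 2 %| (k i).+1)%N ->
  exists2 e, (e < (\prod_(i < s) u i) ^ L)%N &
    #|F|%:R / (4 * (\prod_(i < s) u i)%N%:R ^+ 2) <= `|variation u delta R F w e|.
Proof.
move=> s0 hL hu huu hd kF.
set U := (\prod_(i < s) u i)%N.
have U1 : 1 <= U%:R :> R by rewrite ler1n prod_base_gt0.
have U0 : 0 < U%:R :> R by apply: lt_le_trans U1.
have UU : U%:R <= U%:R ^+ 2 :> R by rewrite expr2 ler_peMr // ltW.
have [even|ne] := eqVneq (2 * (Theta u delta %% U))%N U; last first.
  have [|e he le] := @variation_average s u delta hu huu R L F w s0 ne.
    by move=> k kFk i; have := kF k kFk i; case: (nat_of_ord (k i)).
  exists e => //; apply: le_trans le.
  by rewrite ler_wpM2l // lef_pV2 ?posrE ?mulr_gt0 ?exprn_gt0 // ler_pM2l.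
have s1 : s = 1%N.
  case: (s) s0 u delta F hu huu hd kF @U U1 U0 UU even => [|[|s']] // _ u' d' _ hu' huu' hd' _.
  move=> U U1 U0 UU even.
  have e2 i := Theta_half_even huu' (hd' i) even.
  have := huu' ord0 ord_max isT.
  rewrite /coprime => /eqP gcd1.
  have : (2 %| gcdn (u' ord0) (u' ord_max))%N by rewrite dvdn_gcd !e2.
  by rewrite gcd1.
subst s; case/dvdnP: hL => m; rewrite mulnC => eL; subst L.
have [e he le] := @variation_single R u delta m F w (hu _) (proj2 (andP (hd ord0))) kF.
exists e => //; apply: le_trans le.
rewrite ler_wpM2l // lef_pV2 ?posrE ?mulr_gt0 ?exprn_gt0 //.
have : 0 <= U%:R ^+ 2 :> R by rewrite exprn_ge0 // ltW.
lra.
Qed.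

(** The places 1 to [T * N] contain [N] multiples of [T], shared among [u] values of [g]; the value
    0 never occurs, so it cannot be the frequent one. *)
Lemma digit_gap_pigeonhole (u T N : nat) (g : nat -> nat) :
  (1 < u)%N -> (0 < T)%N -> (forall r, 0 < g r < u)%N ->
  exists2 d, (0 < d < u)%N &
    (N <= u * \sum_(j < T * N) ((T %| j.+1) && (g j.+1 == d)))%N.
Proof.
move=> hu T0 hg; have [->|N0] := posnP N; first by exists 1%N; rewrite ?hu.
pose c d := (\sum_(j < T * N) ((T %| j.+1) && (g j.+1 == d)))%N.
have sumc : (\sum_(d < u) c d = N)%N.
  rewrite exchange_big /= -[RHS](mulKn N T0) divn_count_dvd big_add1 /= big_mkord.
  apply: eq_bigr => j _; case: (T %| j.+1)%N => /=; last by rewrite big1.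
  have /andP[_ lt] := hg j.+1; rewrite (bigD1 (Ordinal lt)) //= eqxx big1 // => i ni.
  by case: eqP => // e; case/eqP: ni; apply: val_inj.
have [/existsP[d hd]|/existsPn none] := boolP [exists d : 'I_u, (N <= u * c d)%N].
  exists d => //; rewrite ltn_ord andbT lt0n; apply: contraTneq hd => ->.
  rewrite (_ : c 0%N = 0%N) ?muln0 -?ltnNge // /c big1 // => j _.
  have /andP[g0 _] := hg j.+1.
  by rewrite (gtn_eqF g0) andbF.
have : (\sum_(d < u) u * c d <= \sum_(d < u) N.-1)%N.
  by apply: leq_sum => d _; have := none d; lia.
by rewrite -big_distrr /= sumc sum_nat_const card_ord leq_mul2l; lia.
Qed.

(** * Decomposition of the box *)

Section Box.
Variables (R : realType) (s : nat) (u v : 'I_s -> nat).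
Variable Sg : forall i : 'I_s, nat -> {perm 'I_(u i)}.
Hypothesis hu : forall i, (1 < u i)%N.
Hypothesis huv : forall i, coprime (u i) (v i).
Hypothesis huu : forall i j, i != j -> coprime (u i) (u j).
Variables (y : 'I_s -> nat -> bool) (L : nat).

Local Notation D i n := (scrambled_digit (v i) (Sg i) n).
Local Notation Y i := (fun r => nat_of_bool (y i r)).
Local Notation rprod k := (\prod_(i < s) u i ^ k i)%N.
Local Notation pprod k := (\prod_(i < s) u i ^ (k i).+1)%N.

Lemma bool_lt_base i r : (Y i r < u i)%N.
Proof. by apply: leq_ltn_trans (hu i); case: (y i r). Qed.

Definition box_count (e : nat) : nat :=
  (\sum_(n < e) [forall i, prefix (u i) (D i n) L < prefix (u i) (Y i) L])%N.

Definition box_vertex (i : 'I_s) : R := (prefix (u i) (Y i) L)%:R / (u i)%:R ^+ L.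

(** A tuple selects one digit 1 in every coordinate of the vertex; [k i] is the number of digits
    before it. *)
Definition box_indices : {set {ffun 'I_s -> 'I_L}} :=
  [set k : {ffun 'I_s -> 'I_L} | [forall i, y i (k i).+1]].

Lemma prod_bool (f : 'I_s -> bool) : (\prod_(i < s) f i)%N = [forall i, f i] :> nat.
Proof.
case: forallP => [h|/forallP/forallPn[i /negbTE fi]]; last by rewrite (bigD1 i) //= fi.
by rewrite big1 // => i _; rewrite h.
Qed.

Lemma card_box_indices : #|box_indices| = (\prod_(i < s) \sum_(j < L) y i j.+1)%N.
Proof.
rewrite bigA_distr_bigA /= -sum1_card big_mkcond /=.
by apply: eq_bigr => k _; rewrite prod_bool inE; case: [forall _, _].
Qed.

(** Expanding the product of the digit sums leaves one elementary volume for each choice of digits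
    1. *)
Lemma prod_box_vertex :
  \prod_(i < s) box_vertex i = \sum_(k in box_indices) (pprod k)%:R^-1.
Proof.
transitivity (\prod_(i < s) \sum_(j < L) (y i j.+1)%:R / (u i)%:R ^+ j.+1 : R).
  by apply: eq_bigr => i _; rewrite /box_vertex -sum_digits_prefix // big_add1 big_mkord.
rewrite bigA_distr_bigA /= [RHS]big_mkcond /=; apply: eq_bigr => k _.
rewrite inE prodf_div -natr_prod prod_bool.
case: [forall _, _]; last by rewrite mul0r.
rewrite mul1r natr_prod; congr (_^-1); apply: eq_bigr => i _; by rewrite natrX.
Qed.

Lemma box_vertex_bounds i r : (r < L)%N -> y i r.+1 -> 0 < box_vertex i <= 1.
Proof.
move=> rL yr; have u0 : 0 < (u i)%:R :> R by rewrite ltr0n; have := hu i; lia.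
apply/andP; split.
  rewrite divr_gt0 ?exprn_gt0 // ltr0n.
  have /andP[+ _] := prefix_mono (bool_lt_base i) (rL : (r.+1 <= L)%N).
  by apply: leq_trans; rewrite /= yr muln_gt0 addn1 expn_gt0; have := hu i; lia.
rewrite ler_pdivrMr ?exprn_gt0 // mul1r -natrX ler_nat ltnW //.
exact/prefix_lt/bool_lt_base.
Qed.

Variables (delta : 'I_s -> nat) (w : nat).
Hypothesis yv : forall i r, y i r -> (v i ^ r = 1 %[mod u i])%N.
Hypothesis yu : forall i j r, y i r -> j != i -> (u i ^ r = 1 %[mod u j])%N.
Hypothesis ydelta : forall i r, y i r -> digit_gap (Sg i) r = delta i.
Hypothesis hw : forall i, prefix (u i) (D i w) L == prefix (u i) (Y i) L.

(** In the piece of index [k], the digits of [n] agree with those of [w] before each selected place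
    and are 0 there instead of 1. By [scrambled_digit_zero] this is one congruence per base. *)
Lemma box_countE e :
  box_count e = (\sum_(k in box_indices) \sum_(n < e)
    ((pprod k)%:Z %| (n%:Z - (w + rprod k * Theta u delta)%N%:Z)%R)%Z)%N.
Proof.
rewrite exchange_big /=; apply: eq_bigr => n _.
rewrite -prod_bool /=.
rewrite (eq_bigr _ (fun i _ => prefix_ltE L (@scrambled_digit_lt _ (v i) (Sg i) (hu i) n)
  (bool_lt_base i))).
rewrite bigA_distr_bigA /= [RHS]big_mkcond /=; apply: eq_bigr => k _.
rewrite inE prod_bool.
have [/forallP yk|/forallPn[i /negbTE nk]] := boolP [forall i, y i (k i).+1]; last first.
  rewrite (_ : [forall _, _] = false) //; apply/negbTE/forallPn.
  by exists i; rewrite nk ltn0 andbF.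
congr nat_of_bool; rewrite prod_dvdz; last first.
  by move=> i j ij; rewrite coprimeXl ?coprimeXr ?huu.
apply: eq_forallb => i.
have /prefix_eqP-/(_ (scrambled_digit_lt _ _ (hu i) _) (bool_lt_base i)) hwi := hw i.
have hwk : prefix (u i) (D i w) (k i) == prefix (u i) (Y i) (k i).
  apply/prefix_eqP => [||r rk]; [exact: scrambled_digit_lt|exact: bool_lt_base|].
  by apply: hwi; apply: ltn_trans rk _.
have w1 : D i w (k i).+1 = 1%N by rewrite hwi // yk.
rewrite -(eqP hwk) yk ltnS leqn0 scrambled_digit_zero ?ydelta ?yk //; last exact: yv.
(* The shift belonging to base [i] may be replaced by the common shift [rprod k * Theta], which
   merges the congruences into one. *)
have : ((u i)%:Z ^+ (k i).+1 %|
    (rprod k * Theta u delta)%N%:Z - (delta i * u i ^ k i)%N%:Z)%Z.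
  rewrite -eqz_mod_dvd -PoszX !modz_nat; apply/eqP; congr Posz.
  by apply: rprod_Theta_mod => // j ji; rewrite (yu (yk j)) // eq_sym.
move=> h; rewrite PoszX.
rewrite (_ : n%:Z - (w + rprod k * Theta u delta)%N%:Z =
  n%:Z - (w + delta i * u i ^ k i)%N%:Z -
  ((rprod k * Theta u delta)%N%:Z - (delta i * u i ^ k i)%N%:Z)); last first.
  by rewrite !PoszD; ring.
exact: esym (rpredBr _ h).
Qed.

Lemma local_discrepancyE e :
  (box_count e)%:R - e%:R * \prod_(i < s) box_vertex i =
  \sum_(k in box_indices)
    ((((w + rprod k * Theta u delta)%N%:Z - e%:Z) %% (pprod k)%:Z)%Z
     - ((w + rprod k * Theta u delta)%N%:Z %% (pprod k)%:Z)%Z)%:~R / (pprod k)%:R.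
Proof.
rewrite box_countE prod_box_vertex natr_sum mulr_sumr -sumrB.
apply: eq_bigr => k _.
have P0 := pprod_gt0 hu (fun i => k i).
have /(congr1 (fun x : int => x%:~R : R)) :=
  count_residueE (w + rprod k * Theta u delta)%N%:Z e P0.
rewrite rmorphM /= -!pmulrn => h.
apply: (mulIf (_ : (pprod k)%:R != 0)); first by rewrite pnatr_eq0 -lt0n.
have Pn : (pprod k)%:R != 0 :> R by rewrite pnatr_eq0 -lt0n.
by rewrite mulrBl h !mulfVK // !rmorphB !rmorphD /= -[e%:R]pmulrn; ring.
Qed.

(** The residues of the class representatives cancel, and at [w] only the residue of
    [rprod k * Theta] is left. *)
Lemma local_discrepancy_diff e :
  ((box_count e)%:R - e%:R * \prod_(i < s) box_vertex i) -
  ((box_count w)%:R - w%:R * \prod_(i < s) box_vertex i) =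
  variation u delta R box_indices w e.
Proof.
rewrite !local_discrepancyE /variation -sumrB; apply: eq_bigr => k _.
rewrite -mulrBl -rmorphB /=; congr (_%:~R / _).
rewrite [X in (X - w%:Z)%R]PoszD [w%:Z + _ - w%:Z]addrC addKr.
ring.
Qed.

End Box.

(** * Star discrepancy of the Halton sequence *)

Section StarDiscrepancy.
Variables (R : realType) (s : nat) (x : nat -> 'rV[R]_s).

Lemma local_discrepancy_le1 (N : nat) (y : 'rV[R]_s) : (forall i, 0 < y ord0 i <= 1) ->
  `| #|[pred n : 'I_N | [forall i, x n ord0 i < y ord0 i]]|%:R / N%:R
     - \prod_(i < s) y ord0 i | <= 1.
Proof.
move=> hy; set a := _ / _; set b := \prod_(i < s) _.
have b0 : 0 <= b by apply: prodr_ge0 => i _; have /andP[/ltW] := hy i.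
have b1 : b <= 1.
  have : b <= \prod_(i < s) (1 : R).
    by apply: ler_prod => i _; have /andP[/ltW -> ->] := hy i.
  by rewrite big1_eq.
have a0 : 0 <= a by rewrite divr_ge0.
have a1 : a <= 1.
  have : (#|[pred n : 'I_N | [forall i, (x n ord0 i < y ord0 i)%R]]| <= N)%N.
    by apply: leq_trans (max_card _) _; rewrite card_ord.
  rewrite /a; move: #|_| => c cN.
  have [->|N0] := posnP N; first by rewrite invr0 mulr0.
  by rewrite ler_pdivrMr ?ltr0n // mul1r ler_nat.
by rewrite ler_norml; apply/andP; split; lra.
Qed.

Lemma star_discrepancy_le1 N : star_discrepancy x N <= 1.
Proof.
apply: ge_sup => [|_ [y hy <-]]; last exact: local_discrepancy_le1.
exists (`| #|[pred n : 'I_N | [forall i, x n ord0 i < (const_mx 1 : 'rV[R]_s) ord0 i]]|%:R / N%:R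
     - \prod_(i < s) (const_mx 1 : 'rV[R]_s) ord0 i |).
by exists (const_mx 1) => // i; rewrite mxE ltr01 lexx.
Qed.

Lemma local_le_star_discrepancy (N : nat) (y : 'rV[R]_s) : (forall i, 0 < y ord0 i <= 1) ->
  `| #|[pred n : 'I_N | [forall i, x n ord0 i < y ord0 i]]|%:R
     - N%:R * \prod_(i < s) y ord0 i | <= N%:R * star_discrepancy x N.
Proof.
move=> hy; have [->|N0] := posnP N.
  rewrite !mul0r subr0 normr_le0 (_ : #|_| = 0%N) //.
  by apply/eqP; rewrite -leqn0 -[X in (_ <= X)%N](card_ord 0) max_card.
have NR : 0 < N%:R :> R by rewrite ltr0n.
rewrite -(@ler_pM2l _ N%:R^-1) ?invr_gt0 // mulKf ?gt_eqF //.
rewrite -[X in X * _]ger0_norm ?invr_ge0 ?ler0n // -normrM mulrBr mulKf ?gt_eqF // mulrC.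
apply: ub_le_sup; last by exists y.
by exists 1 => _ [z hz <-]; exact: local_discrepancy_le1.
Qed.

End StarDiscrepancy.

Lemma limn_esup_ge (R : realType) (a : nat -> R) (c : R) :
  (forall n, exists2 k, (n <= k)%N & c <= a k) ->
  (c%:E <= limn_esup (fun n => (a n)%:E))%E.
Proof.
move=> h; rewrite limn_esup_lim; apply: lime_ge; first exact: is_cvg_esups.
apply: nearW => n; have [k nk ck] := h n.
apply: (@le_trans _ _ (a k)%:E); first by rewrite lee_fin.
by apply: ereal_sup_ubound; exists k.
Qed.

(** * Lower bound for the Halton sequence *)

Section Halton.
Variables (R : realType) (s : nat) (u v : 'I_s -> nat).
Variable Sg : forall i : 'I_s, nat -> {perm 'I_(u i)}.
Hypothesis s0 : (0 < s)%N.
Hypothesis hu : forall i, (1 < u i)%N.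
Hypothesis huv : forall i, coprime (u i) (v i).
Hypothesis huu : forall i j, i != j -> coprime (u i) (u j).

Local Notation x := (halton R v Sg).
Local Notation U := (\prod_(i < s) u i)%N.

(** Comparing prefixes and comparing points disagree only when some coordinate reaches the box
    boundary from below, which happens for at most one [n] per coordinate. *)
Lemma box_count_halton (y : 'I_s -> nat -> bool) (L e : nat) :
  let B := #|[pred n : 'I_e | [forall i, x n ord0 i < box_vertex R u y L i]]| in
  (B <= box_count v Sg y L e <= B + s)%N.
Proof.
pose lo i n := (prefix (u i) (scrambled_digit (v i) (Sg i) n) L <
                prefix (u i) (fun r => nat_of_bool (y i r)) L)%N.
pose E i := [pred n : 'I_e | lo i n && (box_vertex R u y L i <= x n ord0 i)].
pose hit n := [forall i, x n ord0 i < box_vertex R u y L i].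
rewrite /= -sum1_card big_mkcond /=; apply/andP; split.
  apply: leq_sum => n _; rewrite inE; case: ifP => // /forallP h.
  rewrite (introT forallP) // => i; have := h i; rewrite mxE.
  exact: prefix_lt_of_radical_inverse_lt.
have E1 i : (\sum_(n < e) (n \in E i) <= 1)%N.
  rewrite -big_mkcond sum1_card; apply/card_le1P => a.
  rewrite !inE !mxE => /andP[l1 b1] b; rewrite !inE !mxE.
  apply/idP/eqP => [/andP[l2 b2]|->]; last by rewrite l1.
  by apply: val_inj; apply: radical_inverse_boundary_unique l2 l1 b2 b1.
pose c := (\sum_(n < e) (hit n + \sum_(i < s) (n \in E i)))%N.
apply: (@leq_trans c); last first.
  rewrite /c big_split /= leq_add //.
  rewrite exchange_big /= -[X in (_ <= X)%N]muln1.
  rewrite -[X in (_ <= X * _)%N](card_ord s) -sum_nat_const.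
  exact: leq_sum.
apply: leq_sum => n _.
suff : ([forall i, lo i n] <= hit n + \sum_(i < s) (n \in E i))%N by [].
have [/forallP h|] := boolP [forall i, lo i n]; last by [].
have [//|/forallPn[i]] := boolP (hit n).
by rewrite -leNgt => hi; rewrite add0n (bigD1 i) //= inE hi h.
Qed.

(** Each base prescribes a residue modulo [u i ^ L], and the Chinese remainder theorem joins
    them. *)
Lemma exists_base_point (y : 'I_s -> nat -> bool) L :
  exists2 w, (w < U ^ L)%N & forall i, prefix (u i) (scrambled_digit (v i) (Sg i) w) L ==
    prefix (u i) (fun r => nat_of_bool (y i r)) L.
Proof.
have ex i : exists a, prefix (u i) (scrambled_digit (v i) (Sg i) a) L =
    prefix (u i) (fun r => nat_of_bool (y i r)) L.
  exact/scrambled_prefix_surj/prefix_lt/bool_lt_base.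
have [a ha] := choice ex.
have [||w wlt hw] := @chinese_remainder_family s (fun i => u i ^ L)%N _ a.
- by move=> i j ij; rewrite coprimeXl ?coprimeXr ?huu.
- by move=> i; rewrite expn_gt0; have := hu i; lia.
exists w => [|i]; first by rewrite expn_prod.
rewrite -ha scrambled_prefix_eq // -eqz_mod_dvd -PoszX !modz_nat eqz_nat; exact/eqP.
Qed.

(* The factor 2 puts the digits 1 of the box at even places, for [variation_single]
   and to have [2 * U <= P_k] in [variation_average]. *)
Definition period : nat := (2 * \prod_(i < s) totient (u i))%N.

Lemma period_gt0 : (0 < period)%N.
Proof.
rewrite muln_gt0 /=; apply: prodn_gt0 => i.
by rewrite totient_gt0; have := hu i; lia.
Qed.

Lemma expn_period a i r : coprime a (u i) -> (period %| r)%N -> (a ^ r = 1 %[mod u i])%N.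
Proof.
move=> co pr; have /dvdnP[q ->] : (totient (u i) %| r)%N.
  by apply: dvdn_trans pr; rewrite /period (bigD1 i) //= mulnCA dvdn_mulr.
by rewrite mulnC expnM -modnXm Euler_exp_totient // modnXm exp1n.
Qed.

Lemma exists_large_discrepancy N : exists2 n, (n <= U ^ (period * N))%N &
  N%:R ^+ s / (8 * U%:R ^+ 3) - s%:R <= n%:R * star_discrepancy x n.
Proof.
have U0 : 0 < U%:R :> R by rewrite ltr0n prod_base_gt0.
have [->|N0] := posnP N.
  exists 0%N => //; rewrite mul0r expr0n gtn_eqF //= mul0r sub0r oppr_le0 //.
have gap_ok i r : (0 < digit_gap (Sg i) r < u i)%N.
  by rewrite digit_gap_gt0 // digit_gap_lt.
have pig i : exists d, (0 < d < u i)%N /\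
    (N <= u i * \sum_(j < period * N) ((period %| j.+1) && (digit_gap (Sg i) j.+1 == d)))%N.
  have [d d0 hd] := digit_gap_pigeonhole N (hu i) period_gt0 (gap_ok i).
  by exists d.
have [delta hdelta] := choice pig.
pose y i r := (period %| r)%N && (digit_gap (Sg i) r == delta i).
pose L := (period * N)%N.
have [w wlt hw] := exists_base_point y L.
have yv i r : y i r -> (v i ^ r = 1 %[mod u i])%N.
  by move=> /andP[pr _]; apply: expn_period pr; rewrite coprime_sym.
have yu i j r : y i r -> j != i -> (u i ^ r = 1 %[mod u j])%N.
  by move=> /andP[pr _] ji; apply: expn_period pr; rewrite huu // eq_sym.
have ydelta i r : y i r -> digit_gap (Sg i) r = delta i by move=> /andP[_ /eqP].
have key e := local_discrepancy_diff R hu huv huu yv yu ydelta hw e.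
pose F := box_indices y L.
(* The product over [i] of the pigeonhole bounds. *)
have cardF : (N ^ s <= U * #|F|)%N.
  rewrite card_box_indices -big_split /= -[X in (_ ^ X)%N](card_ord s) -prod_nat_const.
  by apply: leq_prod => i _; have [] := hdelta i.
have [e elt he] : exists2 e, (e < U ^ L)%N &
    #|F|%:R / (4 * U%:R ^+ 2) <= `|variation u delta R F w e|.
  apply: variation_large => //.
  - by rewrite /L /period -mulnA dvdn_mulr.
  - by move=> i; have [] := hdelta i.
  - move=> k; rewrite inE => /forallP yk i; have /andP[+ _] := yk i.
    by apply: dvdn_trans; rewrite /period dvdn_mulr.
(* The pigeonhole bound with [N > 0] provides a digit 1 in every coordinate, so the vertex is
   positive. *)
have yvert i : 0 < box_vertex R u y L i <= 1.
  have [_] := hdelta i; case: (boolP [exists j : 'I_L, y i j.+1]) => [/existsP[j yj] _|].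
    exact: box_vertex_bounds yj.
  move=> /existsPn none; rewrite [X in (_ * X)%N]big1 => [|j _].
    by rewrite muln0 leqNgt N0.
  by have /negbTE := none j; rewrite /y => ->.
pose z : 'rV[R]_s := \row_i box_vertex R u y L i.
have zvert i : 0 < z ord0 i <= 1 by rewrite mxE.
have loc n : `|(box_count v Sg y L n)%:R - n%:R * \prod_(i < s) box_vertex R u y L i|
    <= n%:R * star_discrepancy x n + s%:R.
  have := local_le_star_discrepancy x n zvert.
  have /andP[] := box_count_halton y L n.
  rewrite (eq_bigr (box_vertex R u y L)) => [|i _]; last by rewrite mxE.
  rewrite (eq_card (_ : _ =i [pred n0 : 'I_n | [forall i, x n0 ord0 i < z ord0 i]])); last first.
    by move=> a; rewrite !inE; apply: eq_forallb => i; rewrite [z _ _]mxE.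
  move: #|_| => c; rewrite -(ler_nat R) -[(_ <= c + s)%N](ler_nat R) natrD => h1 h2.
  rewrite !ler_norml => /andP[h3 h4]; apply/andP; split; lra.
(* Triangle inequality, with an error of at most [s] boundary points at each of [e] and [w]; hence
   one of the two carries at least half of the bound. *)
have half : #|F|%:R / (4 * U%:R ^+ 2) <= e%:R * star_discrepancy x e +
    w%:R * star_discrepancy x w + 2 * s%:R.
  apply: le_trans he _; rewrite -key; apply: le_trans (ler_normB _ _) _.
  by have := loc e; have := loc w; lra.
have main : 2 * (N%:R ^+ s / (8 * U%:R ^+ 3)) <= #|F|%:R / (4 * U%:R ^+ 2) :> R.
  rewrite (_ : 2 * _ = (N%:R ^+ s / U%:R) / (4 * U%:R ^+ 2)); last by field; rewrite gt_eqF.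
  rewrite ler_pM2r ?invr_gt0 ?mulr_gt0 ?exprn_gt0 //.
  by rewrite ler_pdivrMr // -natrX -natrM ler_nat mulnC.
have [le|gt] := leP (N%:R ^+ s / (8 * U%:R ^+ 3) - s%:R) (e%:R * star_discrepancy x e).
  by exists e => //; exact: ltnW.
by exists w; [exact: ltnW|lra].
Qed.

End Halton.

(* limsup is taken in the extended reals, since it may be +oo. *)
Theorem theorem2p5 (R : realType) (s : nat) (u v : 'I_s -> nat)
    (Sigma : forall i : 'I_s, nat -> {perm 'I_(u i)})
    (hs : (0 < s)%N)
    (hu : forall i, (2 <= u i)%N)
    (hv : forall i, (0 < v i)%N)
    (huv : forall i, coprime (u i) (v i))
    (huu : forall i j, i != j -> coprime (u i) (u j)) :
  (0 < limn_esup (fun N : nat =>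
         (N%:R * star_discrepancy (halton R v Sigma) N / ln N%:R ^+ s)%:E))%E.
Proof.
set U := (\prod_(i < s) u i)%N; set T := period u.
have U2 : (1 < U)%N.
  rewrite /U (bigD1 (Ordinal hs)) //= -[2%N]muln1 leq_mul //.
  by apply: prodn_gt0 => i; have := hu i; lia.
have T0 : (0 < T)%N by exact: period_gt0.
have lnU : 0 < ln (U%:R : R) by rewrite ln_gt0 // ltr1n.
have U0 : 0 < U%:R :> R by rewrite ltr0n; lia.
pose c0 : R := (8 * U%:R ^+ 3)^-1.
have c00 : 0 < c0 by rewrite invr_gt0 mulr_gt0 ?exprn_gt0.
pose C : R := T%:R * ln U%:R.
have C0 : 0 < C by rewrite mulr_gt0 ?ltr0n.
apply: (@lt_le_trans _ _ (c0 / 2 / C ^+ s)%:E).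
  by rewrite lte_fin divr_gt0 ?exprn_gt0 // divr_gt0.
apply: limn_esup_ge => n0.
(* With this [N], half of [c0 * N ^ s] absorbs the error [s] and still exceeds [n0 + 2]. *)
pose N := (Num.truncn (2 * (s%:R + n0%:R + 2) / c0)).+1.
have hN : s%:R + n0%:R + 2 <= c0 / 2 * N%:R.
  have h : 2 * (s%:R + n0%:R + 2) / c0 < N%:R by exact: truncnS_gt.
  move: h; rewrite ltr_pdivrMr //; lra.
have NN : N%:R <= N%:R ^+ s :> R.
  by rewrite -natrX ler_nat -[X in (X <= _)%N]expn1 leq_pexp2l.
have c0NN : c0 / 2 * N%:R <= c0 / 2 * N%:R ^+ s by rewrite ler_pM2l // divr_gt0.
have [k kU hk] := exists_large_discrepancy R Sigma hs hu huv huu N.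
rewrite -/U -/T in kU hk; rewrite [_ / _]mulrC -/c0 in hk.
have kD : k%:R * star_discrepancy (halton R v Sigma) k <= k%:R.
  by rewrite ler_piMr // star_discrepancy_le1.
have n0R : 0 <= n0%:R :> R by [].
have sR : 0 <= s%:R :> R by [].
(* As the star discrepancy is at most 1, a large [k * D_k] forces [k] itself to be large; [k >= 2]
   also makes [ln k] positive. *)
have nk : (n0 + 2 <= k)%N by rewrite -(ler_nat R) natrD; lra.
exists k; first by lia.
have k1 : (1 < k)%N by lia.
have lnk : 0 < ln k%:R :> R by rewrite ln_gt0 // ltr1n.
(* From [k <= U ^ (T * N)]: this turns the power of [N] into a power of [ln k]. *)
have lnkC : ln k%:R <= C * N%:R.
  rewrite /C mulrAC -natrM mulr_natl -lnXn // -natrX ler_ln ?ler_nat // posrE ltr0n.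
    exact: ltnW.
  by rewrite expn_gt0 (ltnW U2).
rewrite /= ler_pdivlMr ?exprn_gt0 //.
apply: (@le_trans _ _ (c0 / 2 / C ^+ s * (C * N%:R) ^+ s)).
  apply: ler_wpM2l; first by rewrite ?divr_ge0 ?exprn_ge0 ?(ltW C0) ?(ltW c00) //.
  by apply: lerXn2r => //; rewrite nnegrE ?mulr_ge0 // ltW.
have Cs : C ^+ s != 0 by rewrite expf_neq0 // gt_eqF.
rewrite [X in _ * X]exprMn [X in X <= _]mulrA mulfVK //; lra.
Qed.
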